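(* Let $(X,\widehat X,\widetilde X)$ be a metrizable compactification pack with $X\ne\varnothing$, let $\mathcal E_0$ be the $C_0$ coarse structure over $\widehat X$ attached to it, let $d$ be a metric on $\widetilde X$ inducing its topology, let $k=\sup_{x\in\widetilde X}d(x,X)$, and let $\lambda:(0,k]\to(0,\infty)$ be increasing and continuous with $\lim_{t\to0}\lambda(t)=0$. Let $E=E_{d,\lambda}$ be the controlled set defined in the context. Then: (a) $\operatorname{mult}_E\alpha\ge\operatorname{asdim}(\widehat X,\mathcal E_0)+1$ for every uniform cover $\alpha$ of $\widehat X$. (b) $\operatorname{mult}\alpha\ge\operatorname{asdim}(\widehat X,\mathcal E_0)+1$ for every uniform cover $\alpha$ of $\widehat X$ such that $\mathcal K(E)\prec\alpha$, where $\mathcal K(E)=\{E_x:x\in\widehat X\}$.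
   Context: A metrizable compactification pack is a triple $(X,\widehat X,\widetilde X)$ where $\widetilde X$ is a metrizable compact space, $X$ is a nowhere dense closed subset of $\widetilde X$, and $\widehat X=\widetilde X\setminus X$. $B(X,t)=\{y\in\widetilde X:d(y,X)<t\}$. ''Increasing'' means $s<t$ implies $\lambda(s)\le\lambda(t)$. Define $h:(0,\infty)\to(0,\infty)$ by $h(t)=\sup_{x\in X}d(x,\widetilde X\setminus B(X,t))$ if $t\le k$ and $h(t)=k$ if $t>k$; $\phi:(0,k]\to(0,\infty)$ by $\phi(t)=h(t)+\lambda(t)+h(t+\lambda(t))$; and $E_{d,\lambda}=\{(x,y)\in\widehat X\times\widehat X:d(x,y)<\phi(\min\{d(x,X),d(y,X)\})\}$. The $C_0$ coarse structure $\mathcal E_0$ over $\widehat X$ is the collection of all $E\subset\widehat X\times\widehat X$ such that for every $\varepsilon>0$ there is a compact $K\subset\widehat X$ with $d(x,y)<\varepsilon$ whenever $(x,y)\in E\setminus(K\times K)$ (independent of the metric). A cover of $\widehat X$ is a collection of subsets with union $\widehat X$; it is uniform if $\bigcup_{U\in\alpha}U\times U\in\mathcal E_0$. $E_x=\{y:(y,x)\in E\}$, $\operatorname{mult}_E\alpha=\sup_{x\in\widehat X}\#\{U\in\alpha:U\cap E_x\ne\varnothing\}$, $\operatorname{mult}\alpha=\sup\{\#A:A\subset\alpha,\ \bigcap_{U\in A}U\ne\varnothing\}$. $\beta\prec\alpha$ means each element of $\beta$ is contained in some element of $\alpha$. $\operatorname{asdim}(Z,\mathcal E)\le m$ means that for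 every uniform cover $\beta$ of $Z$ there is a uniform cover $\alpha$ with $\beta\prec\alpha$ and $\operatorname{mult}\alpha\le m+1$; $\operatorname{asdim}$ is the least such $m$ (or $\infty$). *)

(* Defs.v *)
(* MathComp-Analysis *)
From HB Require Import structures.
From mathcomp Require Import all_boot all_order all_algebra.
From mathcomp Require Import all_classical all_reals all_analysis.
Import Order.TTheory GRing.Theory Num.Theory.
Import numFieldNormedType.Exports.

Set Implicit Arguments.
Unset Strict Implicit.
Unset Printing Implicit Defensive.

Local Open Scope classical_set_scope.
Local Open Scope ring_scope.

(** The compact space is a [metricType]: a topological space bundled with a
    metric [mdist] inducing its topology. The complement of [X], written
    [~` X], plays the role of the space carrying the coarse structure; its
    subsets are represented as sets of the ambient type. *)

Definition nowhere_dense (T : topologicalType) (A : set T) : Prop :=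
  (closure A)° = set0.

Definition compactification_pack (T : topologicalType) (X : set T) : Prop :=
  [/\ compact [set: T], closed X & nowhere_dense X].

Section coarse_structures.
Context {T : Type}.
Implicit Types (Z : set T) (EE : set (set (T * T))) (alpha beta : set (set T)).

Definition is_cover Z alpha : Prop :=
  (forall U, alpha U -> U `<=` Z) /\ \bigcup_(U in alpha) U = Z.

Definition uniform_cover Z EE alpha : Prop :=
  is_cover Z alpha /\ EE (\bigcup_(U in alpha) (U `*` U)).

Definition refines beta alpha : Prop :=
  forall V, beta V -> exists2 U, alpha U & V `<=` U.

(** The varying coordinate is the first one. *)
Definition section_at (E : set (T * T)) (x : T) : set T :=
  [set y | E (y, x)].

Definition sections Z (E : set (T * T)) : set (set T) :=
  [set section_at E x | x in Z].

(** Multiplicities and the asymptotic dimension are extended reals, so that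
    they can take the value [+oo]; [counting A] is the number of elements of
    [A], and [+oo] if [A] is infinite. *)

Definition mult (R : realType) alpha : \bar R :=
  ereal_sup [set counting A | A in
    [set A : set (set T) | A `<=` alpha /\ \bigcap_(U in A) U !=set0]].

Definition mult_wrt (R : realType) Z (E : set (T * T)) alpha : \bar R :=
  ereal_sup [set counting [set U | alpha U /\ U `&` section_at E x !=set0]
            | x in Z].

Definition asdim_le (R : realType) Z EE (m : nat) : Prop :=
  forall beta, uniform_cover Z EE beta ->
    exists alpha, [/\ uniform_cover Z EE alpha, refines beta alpha
                    & (mult R alpha <= (m.+1)%:R%:E)%E].

(** The infimum of a nonempty set of naturals is its least element, and the
    infimum of the empty set is [+oo]. *)
Definition asdim (R : realType) Z EE : \bar R :=
  ereal_inf [set m%:R%:E | m in asdim_le R Z EE].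

End coarse_structures.

Section packs.
Context {R : realType} {T : metricType R}.
Implicit Types (X : set T) (lambda : R -> R).

Definition dist_to (A : set T) (x : T) : R := inf [set mdist x y | y in A].

Definition set_ball X (t : R) : set T := [set y | dist_to X y < t].

(** The coarse structure is expressed through the metric of [T]; it does not
    depend on the choice of a metric inducing the (compact) topology. *)
Definition C0_structure X : set (set (T * T)) :=
  [set E | E `<=` (~` X) `*` (~` X) /\
    forall e : R, 0 < e -> exists K : set T,
      [/\ compact K, K `<=` ~` X
        & forall x y, (E `\` (K `*` K)) (x, y) -> mdist x y < e]].

Definition max_dist X : R := sup [set dist_to X x | x in [set: T]].

(** [h_fun], [phi] and [lambda] are total functions; only their values at
    [t > 0], and at [0 < t <= max_dist X] for the last two, are meaningful. *)
Definition h_fun X (t : R) : R :=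
  if t <= max_dist X then sup [set dist_to (~` set_ball X t) x | x in X]
  else max_dist X.

Definition phi X lambda (t : R) : R :=
  h_fun X t + lambda t + h_fun X (t + lambda t).

Definition E_set X lambda : set (T * T) :=
  [set p | [/\ (~` X) p.1, (~` X) p.2
     & mdist p.1 p.2 < phi X lambda (Num.min (dist_to X p.1) (dist_to X p.2))]].

End packs.

(* Main.v *)
Require Import Defs.
From mathcomp Require Import all_boot all_order all_algebra.
From mathcomp Require Import all_classical all_reals all_analysis.
From mathcomp Require Import lra.
Import Order.TTheory GRing.Theory Num.Theory.
Import numFieldNormedType.Exports.

Local Open Scope classical_set_scope.
Local Open Scope ring_scope.

Set Implicit Arguments.
Unset Strict Implicit.
Unset Printing Implicit Defensive.

(** Write [s x] for the distance from [x] to [X], and [E] for [E_set X lambda].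

    Part (b) holds because a uniform cover [alpha] into which all sections of
    [E] fit yields covers of the same multiplicity at every scale: any uniform
    cover [beta] is coarsened to a uniform cover of multiplicity at most
    [mult R alpha] by pulling [alpha] back along a map [f] of the complement
    of [X] into itself (lemma [shrinking_map]). The graph of [f] is a
    controlled set, so that the preimages of a uniform cover form a uniform
    cover (lemma [uniform_cover_pull]), and [f] maps every member of [beta]
    close to [X] into a single section of [E].

    Such an [f] exists because [E] is very coarse. A point [x] close to [X] is
    moved first to a nearest point of [X], up to a factor, and from there to a
    point of depth [tau x], which costs about [h (tau x)], by the meaning of
    [h]. Suppose that [tau] tends to [0] so slowly that, whenever [x] and [y]
    share a member of [beta] and [tau x <= tau y], the numbers [s x], [s y] and
    [mdist x y] are negligible compared with [lambda (tau x)], and [tau y] is at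
    most [tau x + lambda (tau x)] (lemma [slow_scale]). Then the images of [x]
    and [y] are at distance less than
      [h (tau x) + lambda (tau x) + h (tau x + lambda (tau x))],
    which is [phi (tau x)]: the formula for [phi] is made for this estimate.

    Nothing can be said about the members of [beta] that go far from [X]. They
    all lie in one compact set, so all the members of the pulled back cover
    that meet this set are united into one; this keeps the cover uniform and
    does not increase its multiplicity (lemmas [uniform_cover_amalgam] and
    [mult_amalgam_le]).

    Part (a) follows from part (b) applied to the [E]-neighbourhoods of the
    members of [alpha]: [E] being controlled they form a uniform cover, they
    absorb the sections of [E], and their multiplicity is at most that of
    [alpha] with respect to [E]. *)

(** * Distance to a set, and compactness *)

Section distance_to_set.
Context {R : realType} {T : metricType R}.
Implicit Types (A K : set T) (x y : T) (e t : R).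

Lemma dist_to_ge0 A x : 0 <= dist_to A x.
Proof.
have [->|/set0P[a Aa]] := eqVneq A set0.
  by rewrite /dist_to image_set0 inf0.
apply: lb_le_inf; first by exists (mdist x a), a.
by move=> _ [y _ <-]; exact: mdist_ge0.
Qed.

Lemma dist_to_le A x y : A y -> dist_to A x <= mdist x y.
Proof.
move=> Ay; apply: ge_inf; last by exists y.
by exists 0 => _ [z _ <-]; exact: mdist_ge0.
Qed.

Lemma dist_to_lt A x e : A !=set0 -> dist_to A x < e ->
  exists2 y, A y & mdist x y < e.
Proof.
move=> [a Aa] /inf_lt; case; first by exists (mdist x a), a.
by move=> _ [y Ay <-] ye; exists y.
Qed.

Lemma le_dist_to A x e : A !=set0 -> (forall y, A y -> e <= mdist x y) ->
  e <= dist_to A x.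
Proof.
move=> [a Aa] H; apply: lb_le_inf; first by exists (mdist x a), a.
by move=> _ [y Ay <-]; exact: H.
Qed.

Lemma dist_to_triangle A x y : A !=set0 ->
  dist_to A x <= mdist x y + dist_to A y.
Proof.
move=> A0; rewrite -lerBlDl; apply: le_dist_to => // z Az.
by rewrite lerBlDl (le_trans (dist_to_le x Az))// metric_triangle.
Qed.

Lemma closed_dist_to_gt0 A x : A !=set0 -> closed A -> ~ A x -> 0 < dist_to A x.
Proof.
move=> A0 cA nAx.
have : nbhs x (~` A) by apply: open_nbhs_nbhs; split => //; exact: closed_openC.
move=> /nbhs_ballP[e /= e0]; rewrite ballEmdist => eA; apply: (lt_le_trans e0).
by apply: le_dist_to => // y Ay; rewrite leNgt; apply/negP => /eA; apply.
Qed.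

Lemma dist_to_gt0_notin A x : 0 < dist_to A x -> ~ A x.
Proof. by move=> /[swap] /dist_to_le-/(_ x); rewrite mdistxx ltNge => ->. Qed.

(** Compactness as a passage from local to uniform: a property of points that
    holds locally for all small values of a real parameter holds everywhere
    for all small enough values. *)
Lemma compact_uniform_radius K (P : R -> T -> Prop) : compact K ->
  (forall x, K x -> exists2 e, 0 < e &
     forall t y, 0 < t < e -> mdist x y < e -> P t y) ->
  exists2 e, 0 < e & forall t x, 0 < t < e -> K x -> P t x.
Proof.
move=> /compact_near_coveringP cK H.
have /= := @cK R (0 : R)^'+ (fun t x => 0 < t -> P t x) _; case.
  move=> x Kx; have [e e0 eP] := H x Kx.
  exists ([set y | mdist x y < e], [set t | 0 < t < e]); last first.
    by move=> [y t] /= [xy te] _; exact: eP.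
  split => /=; first by apply/nbhs_ballP; exists e => //=; rewrite ballEmdist.
  near=> t; apply/andP; split; first by near: t; exact: nbhs_right_gt.
  by near: t; exact: nbhs_right_lt.
move=> e /= e0 eP; exists e => // t x /andP[t0 te] Kx.
by apply: (eP t) => //=; rewrite sub0r normrN gtr0_norm.
Unshelve. all: end_near. Qed.

Lemma compact_bounded_mdist : compact [set: T] ->
  exists M, forall x y : T, mdist x y <= M.
Proof.
move=> cT; have [[z]|nT] := pselect (inhabited T); last first.
  by exists 0 => x; case: nT.
have [x _|e e0 eP] := compact_uniform_radius
  (P := fun t y => mdist z y * t <= 1) cT.
  have D0 := mdist_ge0 z x.
  exists (Num.min 1 (mdist z x + 1)^-1).
    by rewrite lt_min ltr01 invr_gt0; lra.
  move=> t y /andP[t0]; rewrite !lt_min => /andP[t1 tD] /andP[y1 _].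
  have tD' : t * (mdist z x + 1) < 1 by rewrite -ltr_pdivlMr ?div1r//; lra.
  apply: le_trans (ltW tD'); rewrite mulrC ler_pM2l//.
  by rewrite (le_trans (metric_triangle z x y))// lerD2l ltW.
have e20 : 0 < e / 2 by rewrite divr_gt0.
have bound y : mdist z y <= (e / 2)^-1.
  by rewrite -[leRHS]mul1r ler_pdivlMr// eP// e20/=; lra.
exists ((e / 2)^-1 + (e / 2)^-1) => x y.
by rewrite (le_trans (metric_triangle x z y))// lerD// metric_sym.
Qed.

End distance_to_set.

(** * Multiplicity and operations on covers *)

Section multiplicity.
Context {R : realType} {T : Type}.
Implicit Types (Z K : set T) (alpha A B : set (set T)) (x y : T).

Lemma counting_image_le (G : set T -> set T) A B : A `<=` G @` B ->
  (@counting _ R A <= counting B)%E.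
Proof.
move=> AGB; have AB : (A #<= B)%card.
  exact: card_le_trans (subset_card_le AGB) (card_image_le _ _).
rewrite /counting; case: (asboolP (finite_set B)) => [finB|_]; last exact: leey.
rewrite asboolT; last exact: card_le_finite AB finB.
have /finite_setP[n Bn] := finB; rewrite lee_fin ler_nat (card_fset_set Bn).
by apply: geq_card_fset_set; rewrite -(card_le_eqr Bn).
Qed.

Lemma counting_ge1 A : A !=set0 -> (1%:E <= @counting _ R A)%E.
Proof.
move=> [U AU]; apply: le_trans (@counting_image_le id [set U] A _); last first.
  by move=> _ ->; exists U.
by rewrite /counting asboolT// fset_set1 finmap.cardfs1.
Qed.

Lemma counting_le_trunc A (r : R) : (counting A <= r%:E)%E ->
  (counting A <= (Num.trunc r)%:R%:E :> \bar R)%E.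
Proof.
rewrite /counting; case: ifPn => [_|_]; last by rewrite leye_eq.
rewrite !lee_fin => nr; rewrite ler_nat truncn_ge_nat//.
exact: le_trans nr.
Qed.

Lemma mult_le alpha (c : \bar R) :
  (forall x, (counting [set U | alpha U /\ U x] <= c)%E) ->
  (mult R alpha <= c)%E.
Proof.
move=> H; apply: ge_ereal_sup => _ [A [Aalpha [x Ax]] <-].
apply: le_trans (H x); apply: (@counting_image_le id) => U AU.
by exists U => //; split; [exact: Aalpha | exact: Ax].
Qed.

Lemma le_mult alpha x : (counting [set U | alpha U /\ U x] <= mult R alpha)%E.
Proof.
apply: ereal_sup_ubound; exists [set U | alpha U /\ U x] => //.
by split=> [U []//|]; exists x => U [].
Qed.

(** Multiplicities are suprema of integers or infinite, so a finite one is
    bounded by its integral part, which is positive since [alpha] covers a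
    point. *)
Lemma asdim_le_mult Z (EE : set (set (T * T))) alpha :
  Z !=set0 -> is_cover Z alpha ->
  (forall m, (mult R alpha <= m.+1%:R%:E)%E -> asdim_le R Z EE m) ->
  (asdim R Z EE + 1 <= mult R alpha)%E.
Proof.
move=> [z Zz] [_ cov] H.
have mult_ge1 : (1%:E <= mult R alpha)%E.
  apply: le_trans (le_mult alpha z); apply: counting_ge1.
  by move: Zz; rewrite -cov => -[U aU Uz]; exists U.
case E : (mult R alpha) mult_ge1 => [r| |] //; last by move=> _; exact: leey.
rewrite lee_fin => r1.
have mult_trunc : (mult R alpha <= (Num.trunc r)%:R%:E)%E.
  by apply: mult_le => x; apply: counting_le_trunc; rewrite -E; exact: le_mult.
have r0 : (0 < Num.trunc r)%N by rewrite truncn_gt0.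
apply: (@le_trans _ _ ((Num.trunc r).-1%:R%:E + 1)%E).
  apply: leeD => //; apply: ereal_inf_lbound; exists (Num.trunc r).-1 => //.
  by apply: H; rewrite prednK.
by rewrite -EFinD natr1 prednK// lee_fin truncn_le (le_trans _ r1).
Qed.

(** Uniting members of a cover is encoded as a map on its members, so that
    multiplicities can be compared along this map. *)
Definition amalgam K alpha (U : set T) : set T :=
  if `[< U `&` K !=set0 >]
  then \bigcup_(V in [set V | alpha V /\ V `&` K !=set0]) V else U.

Lemma sub_amalgam K alpha U : alpha U -> U `<=` amalgam K alpha U.
Proof.
by move=> aU x Ux; rewrite /amalgam; case: asboolP => // UK; exists U.
Qed.

Lemma amalgam_is_cover Z K alpha :
  is_cover Z alpha -> is_cover Z (amalgam K alpha @` alpha).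
Proof.
move=> [aZ cov].
have sub U : alpha U -> amalgam K alpha U `<=` Z.
  move=> aU; rewrite /amalgam; case: asboolP => _; last exact: aZ.
  by apply: bigcup_sub => V [/aZ].
split=> [_ [U aU <-]|]; first exact: sub.
rewrite eqEsubset; split; first by apply: bigcup_sub => _ [U aU <-]; exact: sub.
rewrite -[X in X `<=` _]cov => x [U aU Ux].
by exists (amalgam K alpha U); [exists U | exact: sub_amalgam].
Qed.

(** A point of the amalgam lies in one of its constituents, and all of these
    have the same amalgam. *)
Lemma mult_amalgam_le K alpha :
  (mult R (amalgam K alpha @` alpha) <= mult R alpha)%E.
Proof.
apply: mult_le => x; apply: le_trans (le_mult alpha x).
apply: (@counting_image_le (amalgam K alpha)) => _ [[U aU <-]].
rewrite {1}/amalgam; case: asboolP => UK; last first.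
  by move=> Ux; exists U.
move=> [V [aV VK] Vx]; exists V => //.
by rewrite /amalgam asboolT// asboolT.
Qed.

(** Inverse image of [U] under a relation: the preimage of [U] if [r] is the
    graph of a map, the [E]-neighbourhood of [U] if [r] is an entourage [E]. *)
Definition pull (r : set (T * T)) (U : set T) : set T :=
  [set x | exists2 y, r (x, y) & U y].

Lemma pull_is_cover Z (r : set (T * T)) alpha :
  r `<=` Z `*` Z -> (forall x, Z x -> exists y, r (x, y)) ->
  is_cover Z alpha -> is_cover Z (pull r @` alpha).
Proof.
move=> rZ rtot [aZ cov].
have sub U : pull r U `<=` Z by move=> x [y /rZ []].
split=> [_ [U aU <-]|]; first exact: sub.
rewrite eqEsubset; split; first by apply: bigcup_sub => _ [U aU <-]; exact: sub.
move=> x Zx; have [y rxy] := rtot x Zx; have [_ /= Zy] := rZ _ rxy.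
move: Zy; rewrite -cov => -[U aU Uy].
by exists (pull r U); [exists U | exists y].
Qed.

Lemma mult_pull_graph_le (f : T -> T) Z alpha :
  (mult R (pull [set p | Z p.1 /\ p.2 = f p.1] @` alpha) <= mult R alpha)%E.
Proof.
apply: mult_le => x; apply: le_trans (le_mult alpha (f x)).
apply: (@counting_image_le (pull [set p | Z p.1 /\ p.2 = f p.1])).
by move=> _ [[U aU <-] [y [/= Zx ->] Uy]]; exists U.
Qed.

(** By symmetry of [E], the [E]-neighbourhoods that contain [x] are those of the
    members of [alpha] that meet the section of [E] at [x]. *)
Lemma mult_pull_le_mult_wrt Z (E : set (T * T)) alpha :
  Z !=set0 -> E `<=` Z `*` Z -> (forall x y, E (x, y) -> E (y, x)) ->
  (mult R (pull E @` alpha) <= mult_wrt R Z E alpha)%E.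
Proof.
move=> [z Zz] EZ Esym; apply: mult_le => x.
have [Zx|nZx] := pselect (Z x); last first.
  apply: (@le_trans _ _
    (counting [set U | alpha U /\ U `&` section_at E z !=set0])).
    apply: (@counting_image_le id) => _ [[U aU <-] [y /EZ [/= Zx]]].
    by have := nZx Zx.
  by apply: ereal_sup_ubound; exists z.
apply: (@le_trans _ _
  (counting [set U | alpha U /\ U `&` section_at E x !=set0])).
  apply: (@counting_image_le (pull E)) => _ [[U aU <-] [y Exy Uy]].
  by exists U => //; split=> //; exists y; split=> //; exact: Esym.
by apply: ereal_sup_ubound; exists x.
Qed.

End multiplicity.

(** * Uniform covers for the C0 coarse structure *)

Section C0_covers.
Context {R : realType} {T : metricType R}.
Context (X : set T) (cT : compact [set: T]) (cX : closed X) (X0 : X !=set0).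
Implicit Types (K U V : set T) (alpha : set (set T)) (x y z : T) (e t : R).

Local Notation s := (dist_to X).

Lemma dist_to_gt0 x : (~` X) x -> 0 < s x.
Proof. exact: closed_dist_to_gt0. Qed.

Lemma compact_sub_dist_to K : compact K -> K `<=` ~` X ->
  exists2 e, 0 < e & forall x, K x -> e <= s x.
Proof.
move=> cK KX; have [x /KX /dist_to_gt0 sx|e e0 eP] :=
    compact_uniform_radius (P := fun t x => t <= s x) cK.
  exists (s x / 2); first by rewrite divr_gt0.
  by move=> t y /andP[t0 tx] xy; have := dist_to_triangle x y X0; lra.
exists (e / 2); first by rewrite divr_gt0.
by move=> x Kx; apply: eP => //; lra.
Qed.

Lemma compact_dist_to_ge e : compact [set x | e <= s x].
Proof.
apply: subclosed_compact cT _ => //; rewrite -[X in closed X]setCK.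
apply: open_closedC; rewrite openE => x /= /negP; rewrite -ltNge => sx.
apply/nbhs_ballP; exists (e - s x) => /=; first by rewrite subr_gt0.
rewrite ballEmdist => y /= xy; apply/negP; rewrite -ltNge.
by have := dist_to_triangle y x X0; rewrite metric_sym; lra.
Qed.

(** The compact subsets of [~` X] can be replaced by the sets of points at
    distance at least [t] from [X]: these are compact, and every compact subset
    of [~` X] is contained in one of them. *)
Lemma C0_structureP (E : set (T * T)) : C0_structure X E <->
  E `<=` (~` X) `*` (~` X) /\ forall e, 0 < e -> exists2 t, 0 < t &
    forall x y, E (x, y) -> s x < t \/ s y < t -> mdist x y < e.
Proof.
split=> -[EX H]; split=> // e e0.
  have [K [cK KX KP]] := H e e0; have [t t0 tP] := compact_sub_dist_to cK KX.
  exists t => // x y Exy xyt; apply: KP; split=> // -[/= /tP + /tP].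
  by rewrite !leNgt => /negP + /negP; case: xyt.
have [t t0 tP] := H e e0; exists [set x | t <= s x]; split.
- exact: compact_dist_to_ge.
- by move=> x /= tx; apply: dist_to_gt0_notin; exact: lt_le_trans tx.
- move=> x y [Exy /= nK]; apply: tP Exy _; rewrite !ltNge.
  apply/orP; rewrite -negb_and; apply/negP => /andP[tx ty].
  by apply: nK.
Qed.

(** Only one of the two points is required to be near [X], and since the members
    of a cover contribute symmetric sets, it may be taken to be the first. *)
Definition uniformly_small alpha : Prop :=
  forall e, 0 < e -> exists2 t, 0 < t &
    forall U x y, alpha U -> U x -> U y -> s x < t -> mdist x y < e.

Lemma uniform_coverP alpha : uniform_cover (~` X) (C0_structure X) alpha <->
  is_cover (~` X) alpha /\ uniformly_small alpha.
Proof.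
split=> -[cov H]; split=> //.
  move=> e e0; have [_ /(_ e e0)[t t0 tP]] := (C0_structureP _).1 H.
  by exists t => // U x y aU Ux Uy st; apply: tP; [exists U | left].
apply/C0_structureP; split.
  by move=> [x y] [U aU [/= Ux Uy]]; split; apply: (cov.1 U).
move=> e e0; have [t t0 tP] := H e e0; exists t => //.
move=> x y [U aU [/= Ux Uy]] []; first exact: tP Ux Uy.
by rewrite metric_sym; exact: tP Uy Ux.
Qed.

(** A member that comes close to [X] has there a small distance to each of its
    other points, so it stays close to [X]. *)
Lemma uniformly_small_near alpha : uniformly_small alpha ->
  forall e, 0 < e -> exists2 t, 0 < t &
    forall U x y, alpha U -> U x -> U y -> s x < t -> s y < e.
Proof.
move=> H e e0; have [t t0 tP] := H (e / 2) (divr_gt0 e0 (ltr0Sn _ _)).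
exists (Num.min t (e / 2)); first by rewrite lt_min t0 divr_gt0.
move=> U x y aU Ux Uy; rewrite lt_min => /andP[xt xe].
have := tP U x y aU Ux Uy xt; have := dist_to_triangle y x X0.
by rewrite metric_sym; lra.
Qed.

(** The distance from [x] to [y] is estimated by the triangle inequality through
    [x'] and [y'], which are related to them and share a member of [alpha].
    When [x] is near [X], so is [x'], as [r] shrinks near [X]; then so is [y'],
    and [r] also makes the distance from [y] to [y'] small. *)
Lemma uniform_cover_pull (r : set (T * T)) alpha :
  C0_structure X r -> (forall x, (~` X) x -> exists y, r (x, y)) ->
  uniform_cover (~` X) (C0_structure X) alpha ->
  uniform_cover (~` X) (C0_structure X) (pull r @` alpha).
Proof.
move=> /C0_structureP[rX rsmall] rtot /uniform_coverP[cov asmall].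
apply/uniform_coverP; split; first exact: pull_is_cover.
move=> e e0; have e30 : 0 < e / 3 by rewrite divr_gt0.
have [t1 t10 rP] := rsmall _ e30; have [t2 t20 aP] := asmall _ e30.
have [t3 t30 anear] := uniformly_small_near asmall t10.
pose t4 := Num.min t2 t3; have t40 : 0 < t4 by rewrite lt_min t20.
have t420 : 0 < t4 / 2 by rewrite divr_gt0.
have [t5 t50 rP5] := rsmall _ t420.
exists (Num.min t1 (Num.min t5 (t4 / 2))).
  by rewrite !lt_min t10 t50 t420.
move=> _ x y [U aU <-] [x' rxx' Ux'] [y' ryy' Uy'].
rewrite !lt_min => /and3P[xt1 xt5 xt4].
have xx' : mdist x x' < e / 3 by apply: rP rxx' _; left.
have : s x' < t4.
  have := rP5 _ _ rxx' (or_introl xt5); have := dist_to_triangle x' x X0.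
  by rewrite metric_sym; lra.
rewrite lt_min => /andP[x't2 x't3].
have x'y' := aP U x' y' aU Ux' Uy' x't2.
have yy' : mdist y y' < e / 3.
  by apply: rP ryy' _; right; exact: anear Ux' Uy' x't3.
have := metric_triangle x x' y; have := metric_triangle x' y' y.
by rewrite (metric_sym y' y); lra.
Qed.

(** The members of a uniform cover that meet a compact subset of [~` X] all
    stay away from [X], hence so does their union. *)
Lemma uniform_cover_amalgam e alpha : 0 < e ->
  uniform_cover (~` X) (C0_structure X) alpha ->
  uniform_cover (~` X) (C0_structure X)
    (amalgam [set x | e <= s x] alpha @` alpha).
Proof.
move=> e0 /uniform_coverP[cov asmall].
apply/uniform_coverP; split; first exact: amalgam_is_cover.
have [t t0 anear] := uniformly_small_near asmall e0.
move=> e' e'0; have [t' t'0 aP] := asmall _ e'0.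
exists (Num.min t t'); first by rewrite lt_min t0.
move=> _ x y [U aU <-]; rewrite /amalgam; case: asboolP => _; last first.
  by move=> Ux Uy; rewrite lt_min => /andP[_]; exact: aP Ux Uy.
move=> [V [aV [z [Vz /= ez]]] Vx] _; rewrite lt_min => /andP[xt _].
by have := anear V x z aV Vx Vz xt; rewrite ltNge ez.
Qed.

End C0_covers.

(** * The functions h and phi, and the entourage E *)

Section pack_scale.
Context {R : realType} {T : metricType R} (X : set T).
Context (hpack : compactification_pack X) (X0 : X !=set0).
Implicit Types (x y p : T) (e t u : R).

Local Notation s := (dist_to X).
Local Notation k := (max_dist X).
Local Notation h := (h_fun X).

Let cT : compact [set: T]. Proof. by case: hpack. Qed.
Let cX : closed X. Proof. by case: hpack. Qed.

Lemma nowhere_dense_near_compl x e : 0 < e ->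
  exists2 y, (~` X) y & mdist x y < e.
Proof.
move=> e0; apply: contrapT => H; have [_ _ nX] := hpack.
have : (closure X)° x.
  rewrite -(proj1 (closure_id X) cX); apply/nbhs_ballP; exists e => //=.
  rewrite ballEmdist => y /= xy; apply: contrapT => nXy; apply: H.
  by exists y.
by rewrite (nX : _ = set0).
Qed.

Lemma compl_nonempty : (~` X) !=set0.
Proof.
have [x _] := X0; have [y] := nowhere_dense_near_compl x ltr01.
by exists y.
Qed.

Lemma dist_to_le_max x : s x <= k.
Proof.
have [M MP] := compact_bounded_mdist cT; have [p Xp] := X0.
apply: ub_le_sup; last by exists x.
exists M => _ [y _ <-]; exact: le_trans (dist_to_le y Xp) (MP _ _).
Qed.

Lemma max_dist_gt0 : 0 < k.
Proof.
have [x nXx] := compl_nonempty.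
exact: lt_le_trans (dist_to_gt0 cX X0 nXx) (dist_to_le_max x).
Qed.

Lemma exists_far t : t < k -> exists x, t < s x.
Proof.
move=> tk; have [x _] := X0.
have [|_ [y _ <-] ty] := sup_gt _ tk; first by exists (s x), x.
by exists y.
Qed.

Lemma h_fun_ge0 t : 0 <= h t.
Proof.
rewrite /h_fun; case: ifP => _; last exact: ltW max_dist_gt0.
have [[_ [c Sc]]|nS] :=
  pselect (has_sup [set dist_to (~` set_ball X t) x | x in X]).
  have [p Xp] := X0; apply: le_trans (dist_to_ge0 (~` set_ball X t) p) _.
  by apply: ub_le_sup; [exists c | exists p].
by rewrite sup_out.
Qed.

Lemma dist_to_le_h_fun t p : t < k -> X p ->
  dist_to (~` set_ball X t) p <= h t.
Proof.
move=> tk Xp; rewrite /h_fun (ltW tk); apply: ub_le_sup; last by exists p.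
have [M MP] := compact_bounded_mdist cT; have [y ty] := exists_far tk.
exists M => _ [x _ <-]; apply: le_trans (MP x y); apply: dist_to_le.
by move=> /=; apply/negP; rewrite -leNgt ltW.
Qed.

(** The intuitive meaning of [h]: from every point of [X] one reaches depth [t]
    by moving barely further than [h t]. By [h_fun_le], no smaller number has
    this property. *)
Lemma h_fun_push t p e : t < k -> X p -> 0 < e ->
  exists2 y, t <= s y & mdist p y < h t + e.
Proof.
move=> tk Xp e0; have [y ty] := exists_far tk.
have [||z nz pz] := @dist_to_lt _ _ (~` set_ball X t) p (h t + e).
- by exists y => /=; apply/negP; rewrite -leNgt ltW.
- by rewrite (le_lt_trans (dist_to_le_h_fun tk Xp))// ltrDl.
by exists z => //; rewrite leNgt; apply/negP.
Qed.

Lemma h_fun_le t e : t < k ->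
  (forall p, X p -> exists2 y, t <= s y & mdist p y <= e) -> h t <= e.
Proof.
move=> tk H; rewrite /h_fun (ltW tk); have [x Xx] := X0; apply: ge_sup.
  by exists (dist_to (~` set_ball X t) x), x.
move=> _ [p /H[y ty py] <-]; apply: le_trans py; apply: dist_to_le.
by move=> /=; apply/negP; rewrite -leNgt.
Qed.

Lemma h_fun_homo t u : t <= u -> u < k -> h t <= h u.
Proof.
move=> tu uk; apply/ler_addgt0Pr => e e0; apply: h_fun_le => [|p Xp].
  exact: le_lt_trans uk.
have [y uy py] := h_fun_push uk Xp e0.
by exists y; [exact: le_trans uy | exact: ltW].
Qed.

(** As [X] is nowhere dense, every point of [X] has points off [X] within
    [e / 2]; by compactness these can be found at a uniform positive depth. *)
Lemma h_fun_small e : 0 < e ->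
  exists2 u, 0 < u & forall t, 0 < t < u -> h t <= e.
Proof.
move=> e0; have e20 : 0 < e / 2 by rewrite divr_gt0.
have [x Xx|u u0 uP] := compact_uniform_radius
    (P := fun t x => exists2 y, t <= s y & mdist x y <= e)
    (subclosed_compact cX cT (@subsetT _ _)).
  have [y /(dist_to_gt0 cX X0) sy xy] := nowhere_dense_near_compl x e20.
  exists (Num.min (s y) (e / 2)); first by rewrite lt_min sy.
  move=> t x'; rewrite !lt_min => /andP[_ /andP[ty _]] /andP[_ xx'].
  exists y; first exact: ltW.
  by have := metric_triangle x' x y; rewrite (metric_sym x' x); lra.
exists (Num.min u k); first by rewrite lt_min u0 max_dist_gt0.
move=> t; rewrite lt_min => /and3P[t0 tu tk].
by apply: h_fun_le => // p Xp; apply: uP => //; rewrite t0.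
Qed.

Section entourage.
Context (lambda : R -> R).
Context (lambda_gt0 : forall t, 0 < t <= k -> 0 < lambda t).
Context (lambda_homo : forall t u, 0 < t -> t <= u -> u <= k ->
  lambda t <= lambda u).
Context (lambda_small : forall e, 0 < e ->
  exists2 u, 0 < u & forall t, 0 < t < u -> lambda t < e).

Local Notation phi := (phi X lambda).
Local Notation E := (E_set X lambda).

(** The constant value [k] of [h] beyond depth [k] may be smaller than its
    values before, so monotonicity is claimed only for the arguments [t]
    of [phi] up to an [a] for which [a + lambda a] is below [k]. *)
Lemma phi_homo_near0 : exists a, [/\ 0 < a, a < k, a + lambda a < k &
  forall t u, 0 < t -> t <= u -> u <= a -> phi t <= phi u].
Proof.
have k0 := max_dist_gt0; have k20 : 0 < k / 2 by rewrite divr_gt0.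
have [u u0 uP] := lambda_small k20; pose a := Num.min (u / 2) (k / 4).
have a0 : 0 < a by rewrite lt_min !divr_gt0.
have au : a < u by rewrite /a gt_min; apply/orP; left; lra.
have ak4 : a <= k / 4 by rewrite /a ge_min lexx orbT.
clearbody a; have la : lambda a < k / 2 by apply: uP; rewrite a0.
have la0 : 0 < lambda a by apply: lambda_gt0; rewrite a0/=; lra.
have ak : a + lambda a < k by lra.
exists a; split=> //; first by lra.
move=> t v t0 tv va.
have v0 : 0 < v by exact: lt_le_trans tv.
have lv : lambda v <= lambda a by apply: lambda_homo => //; lra.
have ltv : lambda t <= lambda v by apply: lambda_homo => //; lra.
rewrite /phi; apply: lerD; first apply: lerD => //.
  by apply: h_fun_homo => //; lra.
by apply: h_fun_homo; lra.
Qed.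

Lemma phi_small e : 0 < e ->
  exists2 u, 0 < u & forall t, 0 < t < u -> phi t < e.
Proof.
move=> e0; have e40 : 0 < e / 4 by rewrite divr_gt0.
have [u u0 uP] := h_fun_small e40.
have u20 : 0 < u / 2 by rewrite divr_gt0.
have [v v0 vP] := lambda_small e40.
have [w w0 wP] := lambda_small u20.
have k0 := max_dist_gt0.
exists (Num.min (Num.min (u / 2) v) (Num.min w k)).
  by rewrite !lt_min u20 v0 w0.
move=> t /andP[t0]; rewrite !lt_min => /andP[/andP[tu tv] /andP[tw tk]].
have lt0 : 0 < lambda t by apply: lambda_gt0; rewrite t0 ltW.
have ltv : lambda t < e / 4 by apply: vP; rewrite t0.
have ltw : lambda t < u / 2 by apply: wP; rewrite t0.
have : h t <= e / 4 by apply: uP; lra.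
have : h (t + lambda t) <= e / 4 by apply: uP; lra.
by rewrite /phi; lra.
Qed.

Lemma E_set_sub : E `<=` (~` X) `*` (~` X).
Proof. by move=> [x y] []. Qed.

Lemma E_set_sym x y : E (x, y) -> E (y, x).
Proof. by move=> [/= nx ny xy]; split=> //=; rewrite metric_sym minC. Qed.

Lemma E_set_refl x : (~` X) x -> E (x, x).
Proof.
move=> nx; split=> //=; rewrite mdistxx minxx /phi.
have := h_fun_ge0 (s x); have := h_fun_ge0 (s x + lambda (s x)).
suff : 0 < lambda (s x) by lra.
by apply: lambda_gt0; rewrite (dist_to_gt0 cX X0 nx) dist_to_le_max.
Qed.

Lemma E_set_controlled : C0_structure X E.
Proof.
apply/(C0_structureP cT cX X0); split; first exact: E_set_sub.
move=> e e0; have [u u0 uP] := phi_small e0; exists u => //.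
move=> x y [/= nx ny xy] xyu; apply: lt_trans xy (uP _ _).
by rewrite lt_min gt_min !(dist_to_gt0 cX X0)//=; apply/orP.
Qed.

End entourage.
End pack_scale.

(** * Maps that shrink a given uniform cover into sections of E *)

Section slow_descent.
Context {R : realType} (a : R) (lambda : R -> R).
Context (a0 : 0 < a) (lambda_gt0 : forall t, 0 < t <= a -> 0 < lambda t).
Context (lambda_homo : forall t u, 0 < t -> t <= u -> u <= a ->
  lambda t <= lambda u).

(** From [u] one descends by the value of [lambda] at [u / 2], but not below
    [u / 2], so that this value is at most that of [lambda] at the next term.
    Since the steps are bounded below as long as [u] is, the descent tends
    to [0]. *)
Lemma slow_descent : exists t : nat -> R, [/\ t 0%N = a,
  forall n, 0 < t n, forall n, t n.+1 < t n,
  forall n, t n <= t n.+1 + lambda (t n.+1) &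
  forall e, 0 < e -> exists n, t n < e].
Proof.
pose step u := Num.max (u / 2) (u - lambda (u / 2)).
pose t n := iter n step a.
have tS n : t n.+1 = step (t n) by rewrite /t iterS.
have t_bnd n : 0 < t n <= a.
  elim: n => [|n /andP[t0 ta]]; first by rewrite /t/= a0 lexx.
  rewrite tS /step lt_max divr_gt0//= ge_max.
  have : 0 < lambda (t n / 2) by apply: lambda_gt0; lra.
  by move=> l0; apply/andP; split; lra.
have half_bnd n : 0 < t n / 2 <= a by have := t_bnd n; lra.
have t_lt n : t n.+1 < t n.
  have := t_bnd n; have := lambda_gt0 (half_bnd n).
  by rewrite tS /step gt_max => l0 tn; apply/andP; split; lra.
exists t; split=> //.
- by move=> n; have /andP[] := t_bnd n.
- move=> n; have /andP[tn0 tna] := t_bnd n.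
  have le1 : t n / 2 <= t n.+1 by rewrite tS /step le_max lexx.
  have le2 : t n - lambda (t n / 2) <= t n.+1.
    by rewrite tS /step le_max lexx orbT.
  have : lambda (t n / 2) <= lambda (t n.+1).
    apply: lambda_homo => //; first by rewrite divr_gt0.
    by have /andP[] := t_bnd n.+1.
  by lra.
- (* As long as the terms stay above [e], they drop by at least [c]. *)
  move=> e e0; apply: contrapT => /forallNP H.
  have te n : e <= t n by rewrite leNgt; apply/negP; exact: H.
  have ea : e <= a := te 0%N.
  pose c := Num.min (e / 2) (lambda (e / 2)).
  have c0 : 0 < c.
    by rewrite lt_min divr_gt0//=; apply: lambda_gt0; lra.
  have dec n : t n <= a - n%:R * c.
    elim: n => [|n IH]; first by rewrite mul0r subr0.
    suff : t n.+1 <= t n - c by rewrite -natr1 mulrDl mul1r; lra.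
    have := te n; have /andP[tn0 tna] := t_bnd n => en.
    have ce : c <= e / 2 by rewrite /c ge_min lexx.
    have cl : c <= lambda (e / 2) by rewrite /c ge_min lexx orbT.
    have ll : lambda (e / 2) <= lambda (t n / 2) by apply: lambda_homo; lra.
    by rewrite tS /step ge_max; apply/andP; split; lra.
  have := truncnS_gt (a / c); rewrite ltr_pdivrMr// => ac.
  by have := dec (Num.trunc (a / c)).+1; have := te (Num.trunc (a / c)).+1; lra.
Qed.

End slow_descent.

Section shrinking_map.
Context {R : realType} {T : metricType R} (X : set T).
Context (hpack : compactification_pack X) (X0 : X !=set0).
Implicit Types (x y p : T) (e t u : R) (B : set T) (beta : set (set T)).

Local Notation s := (dist_to X).
Local Notation k := (max_dist X).
Local Notation h := (h_fun X).

Let cT : compact [set: T]. Proof. by case: hpack. Qed.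
Let cX : closed X. Proof. by case: hpack. Qed.

(** [tau] is constant, with value [t n], on the layer of points whose distance
    to [X] lies between [S n.+1] and [S n]. The depths [S n] are chosen one
    after the other, so small that a member of [beta] reaching below depth
    [S n.+1] stays below [S n] and is negligible compared with
    [lambda (t n.+1)]. A member of [beta] near [X] then meets at most two
    consecutive layers, and [t n] and [t n.+1] differ by at most
    [lambda (t n.+1)]. *)
Lemma slow_scale (a c : R) (lambda : R -> R) beta :
  0 < a -> 0 < c -> (forall t, 0 < t <= a -> 0 < lambda t) ->
  (forall t u, 0 < t -> t <= u -> u <= a -> lambda t <= lambda u) ->
  uniformly_small X beta ->
  exists (tau : T -> R) (s0 : R), [/\ 0 < s0 <= c,
    forall x, (~` X) x -> 0 < tau x <= a,
    forall e, 0 < e -> exists2 u, 0 < u &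
      forall x, (~` X) x -> s x < u -> tau x < e,
    forall e, 0 < e -> exists2 u, 0 < u &
      forall x, (~` X) x -> tau x < u -> s x < e &
    forall B x y, beta B -> B x -> B y -> (~` X) x -> (~` X) y ->
      s x < s0 -> tau x <= tau y ->
      tau y <= tau x + lambda (tau x) /\
      3 * (s x + s y) + mdist x y < lambda (tau x)].
Proof.
move=> a0 c0 lambda_gt0 lambda_homo bsmall.
have [t [t0 t_gt0 t_lt t_slow t_cvg0]] :=
  slow_descent a0 lambda_gt0 lambda_homo.
have t_anti m n : (m <= n)%N -> t n <= t m.
  elim: n => [|n IH]; first by rewrite leqn0 => /eqP ->.
  rewrite leq_eqVlt => /orP[/eqP -> //|]; rewrite ltnS => /IH.
  exact: le_trans (ltW (t_lt n)).
have t_le_a n : t n <= a by rewrite -t0 t_anti.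
have lt_gt0 n : 0 < lambda (t n) by apply: lambda_gt0; rewrite t_gt0 t_le_a.
(* [v] is an admissible choice for [S n] when [S n.-1] is [u]. *)
pose good n (u v : R) := [/\ 0 < v, v <= u, v <= t n &
  forall B x y, beta B -> B x -> B y -> s x < v ->
    s y < u /\ 3 * (s x + s y) + mdist x y < lambda (t n)].
have /choice[g gP] : forall q : nat * R, exists v, 0 < q.2 -> good q.1 q.2 v.
  move=> [n u] /=; have [u0|nu] := pselect (0 < u); last by exists 0.
  have l0 := lt_gt0 n; set l := lambda (t n) in l0 *.
  (* [3 * (l / 12 + l / 12) + l / 4 < l] *)
  have l40 : 0 < l / 4 by rewrite divr_gt0.
  have l120 : 0 < Num.min u (l / 12) by rewrite lt_min u0 divr_gt0.
  have [u1 u10 P1] := bsmall _ l40.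
  have [u2 u20 P2] := uniformly_small_near X0 bsmall l120.
  exists (Num.min (Num.min u1 u2) (Num.min (Num.min u (l / 12)) (t n))) => _.
  split.
  - by rewrite !lt_min u10 u20 t_gt0 u0 divr_gt0.
  - by rewrite !ge_min lexx !orbT.
  - by rewrite !ge_min lexx !orbT.
  - move=> B x y bB Bx By.
    rewrite !lt_min => /and3P[/andP[x1 x2] /andP[_ xl] _].
    have := P2 B x y bB Bx By x2; rewrite lt_min => /andP[yu yl].
    by split=> //; have := P1 B x y bB Bx By x1; rewrite -/l; lra.
pose S := fix S n := if n is m.+1 then g (m.+1, S m) else g (0%N, c).
have S_gt0 n : 0 < S n.
  elim: n => [|n IH] /=; first by have [] := gP (0%N, c) c0.
  by have [] := gP (n.+1, S n) IH.
have S0good : good 0%N c (S 0%N) by exact: gP (0%N, c) c0.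
have Sgood n : good n.+1 (S n) (S n.+1) by exact: gP (n.+1, S n) (S_gt0 n).
have S_anti m n : (m <= n)%N -> S n <= S m.
  elim: n => [|n IH]; first by rewrite leqn0 => /eqP ->.
  rewrite leq_eqVlt => /orP[/eqP -> //|]; rewrite ltnS => /IH.
  by apply: le_trans; have [] := Sgood n.
(* [L x] is the index of the layer of [x]. The points beyond depth [S 0] are
   all put in layer [0]. *)
have /choice[L LP] : forall x, exists n, (~` X) x ->
    S n.+1 <= s x /\ forall m, (m < n)%N -> s x < S m.+1.
  move=> x; have [nX|XX] := pselect ((~` X) x); last by exists 0%N.
  have exn : exists n, S n.+1 <= s x.
    have [n tn] := t_cvg0 _ (dist_to_gt0 cX X0 nX); exists n.
    have [_ _ St _] := Sgood n; apply: le_trans St _.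
    exact: le_trans (ltW (t_lt n)) (ltW tn).
  exists (ex_minn exn) => _; case: ex_minnP => n Sn nmin; split=> // m mn.
  by rewrite ltNge; apply/negP => /nmin; rewrite leqNgt mn.
exists (t \o L), (S 0%N); split.
- by rewrite S_gt0; have [] := S0good.
- by move=> x _ /=; rewrite t_gt0 t_le_a.
- move=> e e0; have [N tN] := t_cvg0 e e0; exists (S N.+1) => // x nX xS.
  have [SL _] := LP x nX; apply: le_lt_trans (tN); apply: t_anti.
  rewrite leqNgt; apply/negP => LN.
  by have := S_anti (L x).+1 N.+1 (leqW LN); lra.
- move=> e e0; have [N tN] := t_cvg0 e e0; exists (t N) => // x nX /= xt.
  have [_ SL] := LP x nX.
  have NL : (N < L x)%N by rewrite ltnNge; apply/negP => /t_anti; lra.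
  have [_ _ St _] := Sgood N.
  apply: lt_trans (SL N NL) _; apply: le_lt_trans St _.
  exact: lt_trans (t_lt N) tN.
- move=> B x y bB Bx By nx ny xS /= tt.
  have [_ SLx] := LP x nx; have [SLy _] := LP y ny.
  have LL : (L y <= L x)%N.
    rewrite leqNgt; apply/negP => LL.
    by have := t_anti _ _ LL; have := t_lt (L x); lra.
  case: (L x) SLx LL => [|n] SLx LL.
    move: LL; rewrite leqn0 => /eqP ->.
    have [_ _ _ /(_ B x y bB Bx By xS)[_ HS]] := S0good.
    by split=> //; rewrite lerDl ltW.
  have [_ _ _ /(_ B x y bB Bx By (SLx n (leqnn _)))[yS HS]] := Sgood n.
  split=> //; apply: le_trans (t_slow n); apply: t_anti.
  rewrite leqNgt; apply/negP => Ln.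
  by have := S_anti _ _ Ln; lra.
Qed.

Context (lambda : R -> R).
Context (lambda_gt0 : forall t, 0 < t <= k -> 0 < lambda t).
Context (lambda_homo : forall t u, 0 < t -> t <= u -> u <= k ->
  lambda t <= lambda u).
Context (lambda_small : forall e, 0 < e ->
  exists2 u, 0 < u & forall t, 0 < t < u -> lambda t < e).

Local Notation E := (E_set X lambda).

(** The map [f] sends [x] to a point [p] of [X] with [mdist x p < 2 * s x], then
    to a point of depth at least [tau x] at distance less than [h (tau x) + s x]
    from [p]. The slack in both steps accounts for the factor [3] in
    [slow_scale]. *)
Lemma shrinking_map beta : uniformly_small X beta ->
  exists (f : T -> T) (s0 : R), [/\ 0 < s0,
    C0_structure X [set p | (~` X) p.1 /\ p.2 = f p.1] &
    forall B x y, beta B -> B `<=` ~` X -> B x -> B y -> s x < s0 -> s y < s0 ->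
      E (f x, f y)].
Proof.
move=> bsmall.
have [a [a0 ak ala phi_homo]] :=
  phi_homo_near0 hpack X0 lambda_gt0 lambda_homo lambda_small.
have a20 : 0 < a / 2 by rewrite divr_gt0.
have [u u0 hu] := h_fun_small hpack X0 a20.
(* The scale is bounded by [b] so that [f] lands at depth at most [a] near [X],
   where [phi] is increasing. *)
pose b := Num.min a (u / 2).
have b0 : 0 < b by rewrite lt_min a0 divr_gt0.
have ba : b <= a by rewrite /b ge_min lexx.
have bu : b <= u / 2 by rewrite /b ge_min lexx orbT.
have [||] := @slow_scale b (a / 2) lambda beta b0 a20 _ _ bsmall.
- by move=> t /andP[t0 tb]; apply: lambda_gt0; rewrite t0; lra.
- by move=> t v t0 tv vb; apply: lambda_homo => //; lra.
move=> tau [s0 [/andP[s00 s0a] tau_bnd tau_small tau_proper tau_slow]].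
have h_tau x : (~` X) x -> h (tau x) <= a / 2.
  by move=> /tau_bnd /andP[t0 tb]; apply: hu; rewrite t0; lra.
have /choice[f fP] : forall x, exists y, (~` X) x ->
    [/\ tau x <= s y, s y < h (tau x) + s x
      & mdist x y < 3 * s x + h (tau x)].
  move=> x; have [nx|XX] := pselect ((~` X) x); last by exists x.
  have sx := dist_to_gt0 cX X0 nx; have /andP[t0 tb] := tau_bnd x nx.
  have [p Xp xp] : exists2 p, X p & mdist x p < 2 * s x.
    by apply: dist_to_lt => //; lra.
  have [|y ty py] := h_fun_push hpack X0 (_ : tau x < k) Xp sx; first by lra.
  exists y => _; split=> //.
    by have := dist_to_le y Xp; rewrite metric_sym; lra.
  by have := metric_triangle x p y; lra.
have fX x : (~` X) x -> (~` X) (f x).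
  move=> nx; apply: dist_to_gt0_notin; have [tf _ _] := fP x nx.
  by have /andP[t0 _] := tau_bnd x nx; exact: lt_le_trans tf.
exists f, s0; split=> //.
  apply/(C0_structureP cT cX X0); split.
    by move=> [x y] [/= nx ->]; split=> //; exact: fX.
  move=> e e0; have e20 : 0 < e / 2 by rewrite divr_gt0.
  have [v v0 vP] := h_fun_small hpack X0 e20.
  have [w w0 wP] := tau_small v v0.
  pose r := Num.min w (e / 6); have r0 : 0 < r by rewrite lt_min w0 divr_gt0.
  have [q q0 qP] := tau_proper r r0.
  exists (Num.min r q); first by rewrite lt_min r0.
  move=> x _ [/= nx ->] near; have [tf _ xf] := fP x nx.
  have : s x < r.
    case: near; rewrite lt_min => /andP[] // _ fq.
    by apply: qP => //; exact: le_lt_trans fq.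
  rewrite lt_min => /andP[xw xe].
  have : h (tau x) <= e / 2.
    by apply: vP; rewrite wP// andbT; have /andP[] := tau_bnd x nx.
  by lra.
move=> B x y bB BX Bx By xs ys.
wlog tt : x y Bx By xs ys / tau x <= tau y.
  move=> W; have [/W|/ltW /W W'] := leP (tau x) (tau y); first exact.
  by apply: E_set_sym; exact: W'.
have nx := BX x Bx; have ny := BX y By.
have [slow small] := tau_slow B x y bB Bx By nx ny xs tt.
have [txf fxs xf] := fP x nx; have [tyf _ yf] := fP y ny.
split=> /=; [exact: fX | exact: fX | ].
have /andP[tx0 txb] := tau_bnd x nx.
pose m := Num.min (s (f x)) (s (f y)).
have tm : tau x <= m by rewrite le_min txf (le_trans tt).
have ma : m <= a.
  apply: (@le_trans _ _ (s (f x))); first by rewrite /m ge_min lexx.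
  by have := h_tau x nx; lra.
apply: lt_le_trans (phi_homo _ _ tx0 tm ma).
have lta : lambda (tau x) <= lambda a by apply: lambda_homo; lra.
have hy : h (tau y) <= h (tau x + lambda (tau x)).
  by apply: (h_fun_homo hpack X0) => //; lra.
have := metric_triangle (f x) x (f y); have := metric_triangle x y (f y).
by rewrite (metric_sym (f x) x) /phi; lra.
Qed.

End shrinking_map.

(** * Bounds on the asymptotic dimension *)

Section dimension_bound.
Context {R : realType} {T : metricType R} (X : set T).
Context (hpack : compactification_pack X) (X0 : X !=set0).
Context (lambda : R -> R).
Context (lambda_gt0 : forall t, 0 < t <= max_dist X -> 0 < lambda t).
Context (lambda_homo : forall t u, 0 < t -> t <= u -> u <= max_dist X ->
  lambda t <= lambda u).
Context (lambda_small : forall e, 0 < e ->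
  exists2 u, 0 < u & forall t, 0 < t < u -> lambda t < e).

Local Notation s := (dist_to X).
Local Notation E := (E_set X lambda).

Let cT : compact [set: T]. Proof. by case: hpack. Qed.
Let cX : closed X. Proof. by case: hpack. Qed.

(** The cover [alpha], pulled back along a map [f] that shrinks [beta] into
    sections of [E], absorbs the members of [beta] that stay at depth less than
    [s0]. The other ones are contained in the compact set [K], and the union of
    the pulled back members that meet [K] absorbs them all at once. *)
Lemma asdim_le_of_sections (alpha : set (set T)) m :
  uniform_cover (~` X) (C0_structure X) alpha ->
  refines (sections (~` X) E) alpha -> (mult R alpha <= m.+1%:R%:E)%E ->
  asdim_le R (~` X) (C0_structure X) m.
Proof.
move=> ualpha secalpha multalpha beta ubeta.
have [[bZ _] bsmall] := (uniform_coverP cT cX X0 _).1 ubeta.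
have [f [s0 [s00 fclose fE]]] :=
  shrinking_map hpack X0 lambda_gt0 lambda_homo lambda_small bsmall.
set G := [set p | _] in fclose.
have upull : uniform_cover (~` X) (C0_structure X) (pull G @` alpha).
  by apply: uniform_cover_pull => // x nx; exists (f x).
have [r r0 rP] := uniformly_small_near X0 bsmall s00.
pose K := [set x | r <= s x].
exists (amalgam K (pull G @` alpha) @` (pull G @` alpha)); split.
- exact: uniform_cover_amalgam.
- have cover x : (~` X) x -> exists2 U, (pull G @` alpha) U & U x.
    by rewrite -[X in X x -> _](proj2 (proj1 upull)) => -[U]; exists U.
  have pick V : (pull G @` alpha) V ->
      (amalgam K (pull G @` alpha) @` (pull G @` alpha))
        (amalgam K (pull G @` alpha) V) by move=> aV; exists V.
  move=> B bB; have BX := bZ B bB.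
  have [[x [Bx sx]]|far] := pselect (exists x, B x /\ s0 <= s x).
    have BK : B `<=` K.
      move=> y By; rewrite /K/= leNgt; apply/negP => yr.
      by have := rP B y x bB By Bx yr; rewrite ltNge sx.
    have [V aV Vx] := cover x (BX x Bx); exists (amalgam K (pull G @` alpha) V).
      exact: pick.
    move=> y By; have [W aW Wy] := cover y (BX y By).
    rewrite /amalgam asboolT; last by exists x; split=> //; exact: BK.
    by exists W => //; split=> //; exists y; split=> //; exact: BK.
  have near y : B y -> s y < s0.
    by move=> By; rewrite ltNge; apply/negP => sy; apply: far; exists y.
  have [[y By]|B0] := pselect (B !=set0); last first.
    have [z nz] := compl_nonempty hpack X0; have [V aV _] := cover z nz.
    exists (amalgam K (pull G @` alpha) V); first exact: pick.
    by move=> x Bx; case: B0; exists x.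
  have [|U aU EU] := secalpha (section_at E (f y)).
    exists (f y) => //.
    by have [] := fE B y y bB BX By By (near y By) (near y By).
  exists (amalgam K (pull G @` alpha) (pull G U)).
    by apply: pick; exists U.
  move=> x Bx; apply: sub_amalgam; first by exists U.
  exists (f x); first by split=> //=; exact: BX.
  by apply: EU; apply: (fE _ _ _ bB BX Bx By); exact: near.
- apply: le_trans multalpha; apply: le_trans (mult_amalgam_le _ _) _.
  exact: mult_pull_graph_le.
Qed.

Lemma asdim_add1_le_mult (alpha : set (set T)) :
  uniform_cover (~` X) (C0_structure X) alpha ->
  refines (sections (~` X) E) alpha ->
  (asdim R (~` X) (C0_structure X) + 1 <= mult R alpha)%E.
Proof.
move=> ualpha secalpha; apply: asdim_le_mult.
- exact: compl_nonempty hpack X0.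
- by case: ualpha.
- by move=> m; exact: asdim_le_of_sections.
Qed.

Lemma sections_refine_pull (alpha : set (set T)) :
  is_cover (~` X) alpha -> refines (sections (~` X) E) (pull E @` alpha).
Proof.
move=> [_ cov] _ [x + <-]; rewrite -[X in X x](cov) => -[U aU Ux].
by exists (pull E U); [exists U | move=> y Eyx; exists x].
Qed.

Lemma asdim_add1_le_mult_wrt (alpha : set (set T)) :
  uniform_cover (~` X) (C0_structure X) alpha ->
  (asdim R (~` X) (C0_structure X) + 1 <= mult_wrt R (~` X) E alpha)%E.
Proof.
move=> ualpha.
apply: le_trans (_ : (mult R (pull E @` alpha) <= _)%E); last first.
  apply: mult_pull_le_mult_wrt; first exact: compl_nonempty hpack X0.
    exact: E_set_sub.
  exact: E_set_sym.
apply: asdim_add1_le_mult; last by apply: sections_refine_pull; case: ualpha.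
apply: uniform_cover_pull => //; first exact: E_set_controlled.
by move=> x nx; exists x; exact: E_set_refl.
Qed.

End dimension_bound.

Theorem corollary41 (R : realType) (T : metricType R) (X : set T)
  (hpack : compactification_pack X) (hX : X !=set0)
  (lambda : R -> R)
  (lambda_gt0 : forall t, 0 < t <= max_dist X -> 0 < lambda t)
  (lambda_incr : forall s t, 0 < s -> s < t -> t <= max_dist X ->
     lambda s <= lambda t)
  (lambda_cont : {within [set t | 0 < t <= max_dist X], continuous lambda})
  (lambda_lim : lambda t @[t --> 0^'+] --> 0) :
  (forall alpha, uniform_cover (~` X) (C0_structure X) alpha ->
     (asdim R (~` X) (C0_structure X) + 1
        <= mult_wrt R (~` X) (E_set X lambda) alpha)%E) /\
  (forall alpha, uniform_cover (~` X) (C0_structure X) alpha ->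
     refines (sections (~` X) (E_set X lambda)) alpha ->
     (asdim R (~` X) (C0_structure X) + 1 <= mult R alpha)%E).
Proof.
have lambda_homo t u : 0 < t -> t <= u -> u <= max_dist X ->
    lambda t <= lambda u.
  by rewrite le_eqVlt => t0 /orP[/eqP -> //|]; exact: lambda_incr.
have lambda_small e : 0 < e ->
    exists2 u, 0 < u & forall t, 0 < t < u -> lambda t < e.
  move=> e0; have /cvgrPdist_lt/(_ e e0)[u /= u0 uP] := lambda_lim.
  exists u => // t /andP[t0 tu]; apply: le_lt_trans (ler_norm _) _.
  rewrite -normrN -[- _]sub0r; apply: uP => //=.
  by rewrite sub0r normrN gtr0_norm.
split=> alpha ualpha; first exact: asdim_add1_le_mult_wrt.
exact: asdim_add1_le_mult.
Qed.
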